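(* Input-output conformance simulation (ioco-s) is a precongruence for each GSOS language in ioco-s format: for every n-ary operation f of such a language and all states p_1,...,p_n,q_1,...,q_n of an LTS with inputs and outputs, if p_i ioco-s q_i for each 1 ≤ i ≤ n, then f(p_1,...,p_n) ioco-s f(q_1,...,q_n).
   Context: An LTS with inputs and outputs is (S,I,O,→) with disjoint finite sets I (input actions a?, b?, ...) and O (output actions a!, b!, ..., including the quiescence action δ!), L = I ∪ O, transition relation → ⊆ S × L × S (image-finite), such that p -δ!-> p' iff p = p' and p has no transition labelled by any a! ∈ O∖{δ!}. ins(p) is the set of input actions p can initially perform. A relation R is an ioco-s-relation if for each (p,q) ∈ R: (1) ins(q) ⊆ ins(p); (2) for all a? ∈ ins(q), if p -a?-> p' then q -a?-> q' for some q' with (p',q') ∈ R; (3) for all a! ∈ O, if p -a!-> p' then q -a!-> q' for some q' with (p',q') ∈ R. ioco-s is the largest ioco-s-relation. A GSOS rule for an n-ary operation f has the form: premises {x_i -a_{ij}-> y_{ij} | 1≤i≤n, 1≤j≤m_i} ∪ {x_i -/b_{ik}-> | 1≤i≤n, 1≤k≤ℓ_i}, conclusion f(x_1,...,x_n) -a-> C[x,y], where all x_i, y_{ij} are distinct variables and C is a term over these variables. Its positive (resp. negative) trigger for x_i is {a_{ij}} (resp. {b_{ik}}). A GSOS language is a finite signature, finite label set and finite set of GSOS rules; it defines transitions on closed terms in the standard way. An operation f is in ioco-s format if its defining rules satisfy: (1) every rule whose conclusion is labelled by an input action has only output actions as labels of negative premises and only input actions as labels of positive premises; (2) for each input action a?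 and each pair of rules r = H/(f(x_1,...,x_n) -a?-> t) and r' = H'/(f(x_1,...,x_n) -a?-> t'), there is a rule r'' = H''/(f(x_1,...,x_n) -a?-> t') such that (a) for each i, the positive trigger for x_i in r'' is included in that in r; (b) for each i, the negative trigger for x_i in r'' is included in that in r; (c) if x_i -b?-> z is in H'' and z occurs in t', then x_i -b?-> z is also in H'; (3) every rule whose conclusion is labelled by an output action has only input actions as labels of negative premises and only output actions as labels of positive premises. A GSOS language is in ioco-s format if each of its operations is. *)

(* Defs.v *)
From mathcomp Require Import all_boot.
From Stdlib Require List.

Set Implicit Arguments.
Unset Strict Implicit.
Unset Printing Implicit Defensive.

(* The disjoint finite sets of input and output actions
   are two finTypes I and O, and L = I + O: [inl a] is the input action a?,
   [inr a] the output action a!.  The quiescence action is some delta : O. *)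

Section LTS.

Variables (I O : finType) (S : Type) (trans : S -> I + O -> S -> Prop).

Definition image_finite : Prop :=
  forall p a, exists s : seq S, forall p', trans p a p' -> List.In p' s.

Definition quiescent (delta : O) (p : S) : Prop :=
  forall a : O, a != delta -> forall p', ~ trans p (inr a) p'.

(* (S, I, O, trans) is an LTS with inputs and outputs. *)
Definition is_iolts (delta : O) : Prop :=
  image_finite /\
  (forall p p', trans p (inr delta) p' <-> p = p' /\ quiescent delta p).

Definition ins (p : S) (a : I) : Prop := exists p', trans p (inl a) p'.

Definition ioco_s_relation (R : S -> S -> Prop) : Prop :=
  forall p q, R p q ->
  [/\ forall a, ins q a -> ins p a,
      forall a, ins q a -> forall p', trans p (inl a) p' ->
        exists2 q', trans q (inl a) q' & R p' q'
    & forall a p', trans p (inr a) p' ->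
        exists2 q', trans q (inr a) q' & R p' q'].

Definition ioco_s (p q : S) : Prop :=
  exists2 R, ioco_s_relation R & R p q.

Lemma ioco_s_largest :
  ioco_s_relation ioco_s /\
  forall R, ioco_s_relation R -> forall p q, R p q -> ioco_s p q.
Proof.
split=> [p q [R Rr pq]|R Rr p q pq]; last by exists R.
have [h1 h2 h3] := Rr p q pq; split=> // [a qa p' tp|a p' tp].
  by have [q' tq pq'] := h2 a qa p' tp; exists q' => //; exists R.
by have [q' tq pq'] := h3 a p' tp; exists q' => //; exists R.
Qed.

End LTS.

Record signature := Signature {
  operation :> finType;
  arity : operation -> nat
}.

(* Finite functions as argument vectors make Leibniz equality of terms
   coincide with syntactic identity. *)
Inductive term (Sig : signature) (V : Type) : Type :=
| Var of V
| App (f : Sig) of {ffun 'I_(arity f) -> term Sig V}.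

Arguments Var {Sig V} _.
Arguments App {Sig V} f _.

Definition closed_term (Sig : signature) : Type := term Sig void.

Fixpoint occurs (Sig : signature) V (v : V) (t : term Sig V) : Prop :=
  match t with
  | Var w => w = v
  | App f ts => exists i, occurs v (ts i)
  end.

Fixpoint subst (Sig : signature) V W (s : V -> term Sig W) (t : term Sig V) : term Sig W :=
  match t with
  | Var v => s v
  | App f ts => App f [ffun i => subst s (ts i)]
  end.

(* A GSOS rule for f.  All the rules for f share the source f(x_1, ..., x_n);
   in the target, [inl i] is the argument variable x_i and [inr y] the variable
   with name y : nat, so the x_i are distinct from each other and from all the
   y_ij.  The names y are comparable across different rules.  An element
   (b, y) of [pos i] is the premise x_i -b-> y, and an element b of [neg i] is
   the premise x_i -/b->. *)
Record gsos_rule (I O : finType) (Sig : signature) (f : Sig) := GsosRule {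
  pos : 'I_(arity f) -> seq ((I + O) * nat);
  neg : 'I_(arity f) -> seq (I + O);
  action : I + O;
  target : term Sig ('I_(arity f) + nat);
  pos_vars := flatten [seq [seq ay.2 | ay <- pos i] | i <- enum 'I_(arity f)];
  pos_vars_uniq : uniq pos_vars;
  target_vars : forall y : nat, occurs (inr y) target -> y \in pos_vars
}.

Definition pos_trigger (I O : finType) (Sig : signature) (f : Sig) (r : gsos_rule I O f)
  (i : 'I_(arity f)) : seq (I + O) := [seq ay.1 | ay <- pos r i].

Definition neg_trigger (I O : finType) (Sig : signature) (f : Sig) (r : gsos_rule I O f)
  (i : 'I_(arity f)) : seq (I + O) := neg r i.

Record gsos_language (I O : finType) := GsosLanguage {
  sig :> signature;
  nrules : sig -> nat;
  rule : forall f : sig, 'I_(nrules f) -> gsos_rule I O f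
}.

(* Negative premises rule out an inductive definition, but premises only
   concern the arguments, so the transition relation is determined by
   recursion on the source. *)
Fixpoint gsos_trans (I O : finType) (G : gsos_language I O)
  (p : closed_term G) (a : I + O) (p' : closed_term G) {struct p} : Prop :=
  match p with
  | Var v => match v with end
  | App f ps =>
      exists (k : 'I_(nrules f)) (s : nat -> closed_term G),
      let r := rule k in
      [/\ action r = a,
          forall i b y, (b, y) \in pos r i -> gsos_trans (ps i) b (s y),
          forall i b, b \in neg r i -> forall t, ~ gsos_trans (ps i) b t
        & p' = subst (fun v => match v with inl i => ps i | inr y => s y end)
                     (target r)]
  end.

Definition is_input (I O : finType) (a : I + O) : bool := if a is inl _ then true else false.
Definition is_output (I O : finType) (a : I + O) : bool := ~~ is_input a.

Section Format.

Variables (I O : finType) (G : gsos_language I O).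

Definition op_in_ioco_s_format (f : G) : Prop :=
  [/\ forall k : 'I_(nrules f), is_input (action (rule k)) ->
        forall i, {subset neg_trigger (rule k) i <= @is_output I O} /\
                  {subset pos_trigger (rule k) i <= @is_input I O},
      forall (a : I) (k k' : 'I_(nrules f)),
        action (rule k) = inl a -> action (rule k') = inl a ->
        exists k'' : 'I_(nrules f),
        let r := rule k in let r' := rule k' in let r'' := rule k'' in
        [/\ action r'' = inl a, target r'' = target r',
            forall i, {subset pos_trigger r'' i <= pos_trigger r i},
            forall i, {subset neg_trigger r'' i <= neg_trigger r i}
          & forall i (b : I) z, (inl b, z) \in pos r'' i ->
              occurs (inr z) (target r') -> (inl b, z) \in pos r' i]
    & forall k : 'I_(nrules f), is_output (action (rule k)) ->
        forall i, {subset neg_trigger (rule k) i <= @is_input I O} /\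
                  {subset pos_trigger (rule k) i <= @is_output I O}].

Definition in_ioco_s_format : Prop := forall f : G, op_in_ioco_s_format f.

End Format.

(* Main.v *)
Require Import Defs.
From mathcomp Require Import all_boot.

Set Implicit Arguments.
Unset Strict Implicit.
Unset Printing Implicit Defensive.

(* The congruence closure of ioco-s is itself an ioco-s-relation, by induction
   on its derivation.  Suppose the arguments p_i, q_i satisfy the three clauses.
   A rule fired by f(q) under an input label tests the enabledness of inputs
   and the absence of outputs, both of which q_i passes on to p_i; a rule fired
   by f(p) under an output label tests the reverse.  Matching an input step of
   f(p) by rule r', when f(q) fires some rule r for the same label, uses the
   rule r'' of the format: its triggers are among those of r, so f(q) fires it,
   and the successors occurring in the target can be chosen to match those
   used by r'. *)

(** Finite choice by induction on the list: as the keys are distinct, setting the value at the key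
    of the head leaves the choices for the tail intact. *)
Lemma uniq_key_choice (A K : eqType) (T : Type) (t0 : T) (key : A -> K)
  (P : A -> T -> Prop) (l : seq A) :
  uniq (map key l) -> (forall a, a \in l -> exists t, P a t) ->
  exists s : K -> T, forall a, a \in l -> P a (s (key a)).
Proof.
elim: l => [|a l IHl] /=; first by exists (fun=> t0).
case/andP=> al ul ex.
have [b bl|s Ps] := IHl ul; first by apply: ex; rewrite inE bl orbT.
have [t Pt] := ex a (mem_head a l).
exists (fun k => if k == key a then t else s k) => b.
rewrite inE => /predU1P[->|bl]; first by rewrite eqxx.
case: eqP => [ba|_]; last exact: Ps.
by rewrite -ba map_f in al.
Qed.

Lemma mem_pos_vars (I O : finType) (Sig : signature) (f : Sig)
  (r : gsos_rule I O f) (y : nat) :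
  y \in pos_vars r -> exists i b, (b, y) \in pos r i.
Proof.
case/flattenP=> _ /mapP[i _ ->] /mapP[[b z] bz ->].
by exists i, b.
Qed.

(** Firing a rule takes one valuation of all the y_ij, while simulation yields successors premise by
    premise; distinctness of the y_ij lets them be glued. *)
Lemma pos_valuation (I O : finType) (Sig : signature) (f : Sig)
  (r : gsos_rule I O f) (T : Type) (t0 : T)
  (P : 'I_(arity f) -> I + O -> nat -> T -> Prop) :
  (forall i b y, (b, y) \in pos r i -> exists t, P i b y t) ->
  exists s : nat -> T, forall i b y, (b, y) \in pos r i -> P i b y (s y).
Proof.
move=> ex.
pose l := [seq (i, ay) | i <- enum 'I_(arity f), ay <- pos r i].
have ul : uniq [seq u.2.2 | u <- l].
  by rewrite map_allpairs; exact: pos_vars_uniq.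
have [u|s Ps] := uniq_key_choice (P := fun u => P u.1 u.2.1 u.2.2) t0 ul.
  by case/allpairsPdep=> i [[b y] [_ biy ->]]; exact: ex.
exists s => i b y biy; apply: (Ps (i, (b, y))).
by apply/allpairsPdep; exists i, (b, y); rewrite mem_enum.
Qed.

Inductive congruence_closure (Sig : signature)
  (R : closed_term Sig -> closed_term Sig -> Prop) :
  closed_term Sig -> closed_term Sig -> Prop :=
| congruence_base p q : R p q -> congruence_closure R p q
| congruence_app (f : Sig) (p q : {ffun 'I_(arity f) -> closed_term Sig}) :
    (forall i, congruence_closure R (p i) (q i)) ->
    congruence_closure R (App f p) (App f q).

Lemma congruence_subst (Sig : signature)
  (R : closed_term Sig -> closed_term Sig -> Prop) (V : Type)
  (s s' : V -> closed_term Sig) (t : term Sig V) :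
  (forall v, occurs v t -> congruence_closure R (s v) (s' v)) ->
  congruence_closure R (subst s t) (subst s' t).
Proof.
(* A direct fixpoint reaches the subterms nested in the finite function [ts]. *)
move: t; fix IH 1; case=> [v|f ts] ss' /=; first exact: ss'.
apply: congruence_app => i; rewrite !ffunE; apply: IH => v vi.
by apply: ss'; exists i.
Qed.

Section IocoFormat.

Variables (I O : finType) (G : gsos_language I O).
Hypothesis Gfmt : in_ioco_s_format G.

Let trans := @gsos_trans I O G.

(** Localising the clauses to one pair lets them serve as induction hypothesis on the arguments. *)
Definition ioco_s_step (R : closed_term G -> closed_term G -> Prop)
  (p q : closed_term G) : Prop :=
  [/\ forall a, ins trans q a -> ins trans p a,
      forall a, ins trans q a -> forall p', trans p (inl a) p' ->
        exists2 q', trans q (inl a) q' & R p' q'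
    & forall a p', trans p (inr a) p' ->
        exists2 q', trans q (inr a) q' & R p' q'].

Lemma ioco_s_step_mono (R R' : closed_term G -> closed_term G -> Prop)
  (p q : closed_term G) :
  (forall t u, R t u -> R' t u) -> ioco_s_step R p q -> ioco_s_step R' p q.
Proof.
move=> RR' [h1 h2 h3]; split=> // [a qa p' tp|a p' tp].
  by have [q' tq /RR'] := h2 a qa p' tp; exists q'.
by have [q' tq /RR'] := h3 a p' tp; exists q'.
Qed.

Lemma ins_app (R : closed_term G -> closed_term G -> Prop) (f : G)
  (p q : {ffun 'I_(arity f) -> closed_term G}) (a : I) :
  (forall i, ioco_s_step R (p i) (q i)) ->
  ins trans (App f q) a -> ins trans (App f p) a.
Proof.
move=> pq_step [_ [k [s /= [ka posq negq _]]]].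
have [fmt_in _ _] := Gfmt f.
have {}fmt_in := fmt_in k; rewrite ka in fmt_in.
(* [App f p] is a mere default, for names bound by no premise. *)
have [i b y biy|s' posp] := pos_valuation (r := rule k)
    (P := fun i b _ t => trans (p i) b t) (App f p).
  have [_ /(_ b (map_f fst biy))] := fmt_in isT i.
  case: b biy => // b biy _; have [h1 _ _] := pq_step i.
  by apply: h1; exists (s y); exact: posq biy.
eexists; exists k, s'; split=> // i b bi t tp.
have [/(_ b bi) + _] := fmt_in isT i.
case: b bi tp => // b bi tp _; have [_ _ h3] := pq_step i.
by have [t' tq _] := h3 b t tp; exact: negq bi _ tq.
Qed.

Lemma ioco_s_step_app (R : closed_term G -> closed_term G -> Prop) (f : G)
  (p q : {ffun 'I_(arity f) -> closed_term G}) :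
  (forall i, congruence_closure R (p i) (q i)) ->
  (forall i, ioco_s_step (congruence_closure R) (p i) (q i)) ->
  ioco_s_step (congruence_closure R) (App f p) (App f q).
Proof.
move=> pq pq_step; have [fmt_in fmt_mix fmt_out] := Gfmt f.
split; first by move=> a; exact: ins_app pq_step.
- move=> a [_ [k [sq [ka posq negq _]]]] _ [k' [sp /= [k'a posp _ ->]]].
  have [k'' [k''a tgt posk negk posk']] := fmt_mix a k k' ka k'a.
  have {}fmt_in := fmt_in k''; rewrite k''a in fmt_in.
  (* Successors need to be related only for variables that the target uses. *)
  have [i b y biy|s' posq'] := pos_valuation (r := rule k'')
      (P := fun i b y t => trans (q i) b t /\
        (occurs (inr y) (target (rule k')) -> congruence_closure R (sp y) t))
      (App f q).
    have bi := map_f fst biy.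
    have /mapP[[b' z] bzi /= bb'] := posk i b bi; subst b'.
    have tq : trans (q i) b (sq z) by exact: posq bzi.
    (* A premise shared with [k'] is matched by clause 2, [sq z] witnessing that q_i enables [b].
       For any other premise, condition (c) keeps [y] out of the target, so [sq z] itself will
       do. *)
    case/boolP: ((b, y) \in pos (rule k') i) => [biy'|nbiy]; last first.
      exists (sq z); split=> // yt; have [_ /(_ b bi)] := fmt_in isT i.
      case: b biy bi bzi tq nbiy => // b biy _ _ _ /negP nbiy _.
      by case: nbiy; exact: posk' biy yt.
    have [_ /(_ b bi)] := fmt_in isT i.
    case: b biy' tq {biy bi bzi} => // b biy tq _.
    have [_ h2 _] := pq_step i.
    have qb : ins trans (q i) b by exists (sq z).
    by have [t tq' spt] := h2 b qb (sp y) (posp _ _ _ biy); exists t.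
  eexists; first (exists k'', s'; split=> //; first by move=> i b y /posq'[]).
    by move=> i b /negk; exact: negq.
  rewrite tgt; apply: congruence_subst => -[i|y] yt //.
  have [|i [b biy]] := @mem_pos_vars _ _ _ _ (rule k'') y.
    by apply: target_vars; rewrite tgt.
  by have [_] := posq' i b y biy; exact.
- move=> a _ [k [sp /= [ka posp negp ->]]].
  have {}fmt_out := fmt_out k; rewrite ka in fmt_out.
  have [i b y biy|s' posq] := pos_valuation (r := rule k)
      (P := fun i b y t => trans (q i) b t /\ congruence_closure R (sp y) t)
      (App f q).
    have [_ /(_ b (map_f fst biy))] := fmt_out isT i.
    case: b biy => // b biy _; have [_ _ h3] := pq_step i.
    by have [t tq spt] := h3 b _ (posp i _ y biy); exists t.
  eexists; first (exists k, s'; split=> //; first by move=> i b y /posq[]).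
    (* An input enabled in q_i would be enabled in p_i by clause 1, against [negp]. *)
    move=> i b bi t tq; have [/(_ b bi) + _] := fmt_out isT i.
    case: b bi tq => // b bi tq _; have [h1 _ _] := pq_step i.
    by have [|t' tp] := h1 b; [exists t|exact: negp bi _ tp].
  apply: congruence_subst => -[i|y] yt //.
  have [i [b biy]] := mem_pos_vars (target_vars yt).
  by have [_] := posq i b y biy.
Qed.

Lemma congruence_closure_ioco_s :
  ioco_s_relation trans (congruence_closure (ioco_s trans)).
Proof.
move=> p q; elim=> {p q} [p q pq|f p q pq IH]; last exact: ioco_s_step_app.
apply: (ioco_s_step_mono (R := ioco_s trans)); first exact: congruence_base.
exact: (ioco_s_largest trans).1.
Qed.

End IocoFormat.

Theorem theorem5 (I O : finType) (delta : O) (G : gsos_language I O)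
  (Gio : is_iolts (@gsos_trans I O G) delta)
  (Gfmt : in_ioco_s_format G)
  (f : G) (p q : {ffun 'I_(arity f) -> closed_term G})
  (pq : forall i, ioco_s (@gsos_trans I O G) (p i) (q i)) :
  ioco_s (@gsos_trans I O G) (App f p) (App f q).
Proof.
exists (congruence_closure (ioco_s (@gsos_trans I O G))).
  exact: congruence_closure_ioco_s.
by apply: congruence_app => i; exact: congruence_base.
Qed.
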